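(* Let $G_1$ and $G_2$ be two graphs. Then $\delta(G_1)\le \delta(G_1\circ G_2)$.
   Context: All graphs are simple and connected (possibly infinite) and every edge has length $1$. A graph $G$ is viewed as a geodesic metric space by identifying each edge isometrically with $[0,1]$; points of $G$ are its vertices and the interior points of its edges, and $d_G$ is the length of a shortest path. Lexicographic product $G_1\circ G_2$: vertex set $V(G_1)\times V(G_2)$; two distinct vertices $(u_1,v_1)$ and $(u_2,v_2)$ are adjacent if either $[u_1,u_2]\in E(G_1)$, or $u_1=u_2$ and $[v_1,v_2]\in E(G_2)$. A geodesic triangle $T=\{x_1,x_2,x_3\}$ in a geodesic metric space $X$ is the union of three geodesics $[x_1x_2],[x_2x_3],[x_3x_1]$. It is $\delta$-thin if every point of each side is at distance at most $\delta$ from the union of the other two sides; $\delta(T)=\inf\{\delta\ge 0: T \text{ is } \delta\text{-thin}\}$ and $\delta(X)=\sup\{\delta(T): T \text{ a geodesic triangle in } X\}\in[0,\infty]$. *)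

(* Defs.v *)
From HB Require Import structures.
From mathcomp Require Import all_boot all_order all_algebra.
From mathcomp Require Import all_classical all_reals all_analysis.

Set Implicit Arguments.
Unset Strict Implicit.
Unset Printing Implicit Defensive.

Import Order.TTheory GRing.Theory Num.Theory.

Local Open Scope classical_set_scope.
Local Open Scope ring_scope.

(* Simple connected graphs, possibly infinite.  Connectedness includes
   nonemptiness. *)

Record graph := Graph {
  vert : choiceType;
  adj : rel vert;
  adj_sym : symmetric adj;
  adj_irr : irreflexive adj;
  vert_nonempty : inhabited vert;
  adj_conn : forall u v : vert, exists2 p : seq vert, path adj u p & v = last u p
}.

Section Lexicographic.
Variables G1 G2 : graph.

Definition lex_adj : rel (vert G1 * vert G2) := fun p q =>
  adj p.1 q.1 || (p.1 == q.1) && adj p.2 q.2.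

Lemma lex_adj_sym : symmetric lex_adj.
Proof.
move=> p q; rewrite /lex_adj (adj_sym p.1) (adj_sym p.2).
by rewrite [p.1 == _]eq_sym.
Qed.

Lemma lex_adj_irr : irreflexive lex_adj.
Proof. by move=> p; rewrite /lex_adj !adj_irr andbF. Qed.

Lemma lex_nonempty : inhabited (vert G1 * vert G2)%type.
Proof. by have [u] := vert_nonempty G1; have [v] := vert_nonempty G2. Qed.

Lemma lex_conn (p q : vert G1 * vert G2) :
  exists2 s, path lex_adj p s & q = last p s.
Proof.
case: p q => [u1 v1] [u2 v2].
have [p2 hp2 ->] := adj_conn v1 v2.
have [p1 hp1 ->] := adj_conn u1 u2.
exists ([seq (u1, v) | v <- p2] ++ [seq (u, last v1 p2) | u <- p1]).
  rewrite cat_path (last_map (fun v => (u1, v))); apply/andP; split.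
    apply: (homo_path (f := fun v => (u1, v))) hp2 => a b ab.
    by rewrite /lex_adj /= eqxx ab orbT.
  apply: (homo_path (f := fun u => (u, last v1 p2))) hp1 => a b ab.
  by rewrite /lex_adj /= ab.
rewrite last_cat (last_map (fun v => (u1, v))).
by rewrite (last_map (fun u => (u, last v1 p2))).
Qed.

Definition lexprod : graph :=
  Graph lex_adj_sym lex_adj_irr lex_nonempty lex_conn.

End Lexicographic.

(* The geodesic metric space of a graph.  Points are given by their barycentric
   coordinates: [baryc u v s] is the point at distance [s] from [u] on the edge
   [u, v], so that [baryc u v s = baryc v u (1 - s)], and
   [baryc u v 0 = vbaryc u] does not depend on [v]. *)

Section Realization.
Variables (R : realType) (G : graph).
Implicit Types u v w : vert G.

Definition vbaryc u : vert G -> R := fun w => (w == u)%:R.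

Definition baryc u v (s : R) : vert G -> R :=
  fun w => (1 - s) * (w == u)%:R + s * (w == v)%:R.

Definition is_gpoint (x : vert G -> R) : Prop :=
  (exists u, x = vbaryc u) \/
  (exists u v s, [/\ adj u v, 0 < s < 1 & x = baryc u v s]).

Definition gpoint : Type := {x : vert G -> R | is_gpoint x}.

HB.instance Definition _ := gen_eqMixin gpoint.
HB.instance Definition _ := gen_choiceMixin gpoint.

(* [gpath x y l]: some path from [x] to [y], a finite concatenation of segments
   each contained in a closed edge, has length [l]. *)
Inductive gpath : gpoint -> gpoint -> R -> Prop :=
| gpath_nil x : gpath x x 0
| gpath_step x y z u v s t l :
    adj u v -> 0 <= s <= 1 -> 0 <= t <= 1 ->
    sval x = baryc u v s -> sval y = baryc u v t ->
    gpath y z l -> gpath x z (`|s - t| + l).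

(* The infimum is a minimum: a shortest path exists since edges have length 1. *)
Definition gdist (x y : gpoint) : R := inf [set l | gpath x y l].

Lemma gpoint_inj (x y : gpoint) : sval x = sval y -> x = y.
Proof.
case: x y => [x hx] [y hy] /= exy; case: _ / exy in hy *.
by congr exist; exact: Prop_irrelevance.
Qed.

Lemma baryc0 u v : baryc u v 0 = vbaryc u.
Proof. by apply/funext => w; rewrite /baryc /vbaryc subr0 mul1r mul0r addr0. Qed.

Lemma baryc1 u v : baryc u v 1 = vbaryc v.
Proof. by apply/funext => w; rewrite /baryc /vbaryc subrr mul0r mul1r add0r. Qed.

Definition gvert u : gpoint :=
  exist _ (vbaryc u) (or_introl (ex_intro _ u erefl)).

Lemma gpath_ge0 x y l : gpath x y l -> 0 <= l.
Proof. by elim=> // *; rewrite addr_ge0. Qed.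

Lemma gpath_cat x y z l m : gpath x y l -> gpath y z m -> gpath x z (l + m).
Proof.
elim=> [a|a b c u v s t k uv hs ht ea eb _ IH] h; first by rewrite add0r.
by rewrite -addrA; apply: gpath_step uv hs ht ea eb (IH h).
Qed.

Lemma gpath_sym x y l : gpath x y l -> gpath y x l.
Proof.
elim=> [a|a b c u v s t k uv hs ht ea eb _ IH]; first exact: gpath_nil.
rewrite addrC; apply: (gpath_cat IH).
rewrite distrC -[X in gpath _ _ X]addr0.
by apply: gpath_step uv ht hs eb ea _; exact: gpath_nil.
Qed.

Lemma gpath_coord x y l w : gpath x y l -> `|sval x w - sval y w| <= l.
Proof.
elim=> [a|a b c u v s t k uv hs ht ea eb _ IH]; first by rewrite subrr normr0.
rewrite (le_trans (ler_distD (sval b w) _ _))// lerD// ea eb /baryc.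
have [->|_] := eqVneq w u; have [E|_] := eqVneq _ v.
- by rewrite -E adj_irr in uv.
- by rewrite !mulr1 !mulr0 !addr0 distrC opprB addrC addrA subrK addrC.
- by rewrite !mulr1 !mulr0 !add0r.
- by rewrite !mulr0 addr0 subrr normr0.
Qed.

Lemma gpath_vert x : exists u l, gpath x (gvert u) l.
Proof.
case: (svalP x) => [[u ex]|[u [v [s [uv /andP[s0 s1] ex]]]]].
  exists u, 0; have -> : x = gvert u by exact: gpoint_inj.
  exact: gpath_nil.
exists u, (`|s - 0| + 0).
apply: (@gpath_step x (gvert u) _ u v s 0) => //; last exact: gpath_nil.
- by rewrite !ltW.
- by rewrite lexx ler01.
- by rewrite baryc0.
Qed.

Lemma gpath_exists x y : exists l, gpath x y l.
Proof.
have [u [l xu]] := gpath_vert x; have [v [m /gpath_sym vy]] := gpath_vert y.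
suff [k uv] : exists k, gpath (gvert u) (gvert v) k.
  by exists (l + k + m); apply: gpath_cat vy; exact: gpath_cat uv.
have [p + ->] := adj_conn u v.
elim: p u {xu} => [|w p IH] u /=; first by exists 0; exact: gpath_nil.
move=> /andP[uw /IH[k wk]]; exists (`|0 - 1| + k).
by apply: (@gpath_step _ (gvert w) _ u w 0 1);
  rewrite ?lexx ?ler01 ?baryc0 ?baryc1.
Qed.

Lemma gpath_has_inf x y : has_inf [set l | gpath x y l].
Proof.
split; first exact: gpath_exists.
by exists 0 => l; exact: gpath_ge0.
Qed.

Lemma gdist_le x y l : gpath x y l -> gdist x y <= l.
Proof. by move=> h; apply: ge_inf => //; exact: (gpath_has_inf x y).2. Qed.

Lemma le_gdist x y a : (forall l, gpath x y l -> a <= l) -> a <= gdist x y.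
Proof. by move=> h; apply: lb_le_inf => //; exact: gpath_exists. Qed.

Lemma gdistxx x : gdist x x = 0.
Proof.
apply/eqP; rewrite eq_le gdist_le ?le_gdist//; last exact: gpath_nil.
by move=> l; exact: gpath_ge0.
Qed.

Lemma gdist_sym x y : gdist x y = gdist y x.
Proof.
by apply/eqP; rewrite eq_le; apply/andP; split;
  apply: le_gdist => l /gpath_sym; exact: gdist_le.
Qed.

Lemma gdist_triangle y x z : gdist x z <= gdist x y + gdist y z.
Proof.
rewrite -lerBlDr; apply: le_gdist => l xy.
rewrite lerBlDr -lerBlDl; apply: le_gdist => m yz.
by rewrite lerBlDl; exact: gdist_le (gpath_cat xy yz).
Qed.

Lemma gdist_positivity x y : gdist x y = 0 -> x = y.
Proof.
move=> xy0; apply: gpoint_inj; apply/funext => w; apply/eqP.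
rewrite -subr_eq0 -normr_le0 -xy0.
by apply: le_gdist => l; exact: gpath_coord.
Qed.

HB.instance Definition _ := isMetric.Build R gpoint
  gdistxx gdist_positivity gdist_sym gdist_triangle.

End Realization.

Section Hyperbolicity.
Variables (R : realType) (X : metricType R).
Local Open Scope ereal_scope.

(* [S] is (the image of) a geodesic from [x] to [y]. *)
Definition geodesic (x y : X) (S : set X) : Prop :=
  exists gamma : R -> X,
    [/\ gamma 0%R = x, gamma (mdist x y) = y,
        (forall s t : R, s \in `[0%R, mdist x y] -> t \in `[0%R, mdist x y] ->
           mdist (gamma s) (gamma t) = `|s - t|%R)
      & S = gamma @` [set` `[0%R, mdist x y]]].

Definition geodesic_triangle (x1 x2 x3 : X) (S12 S23 S31 : set X) : Prop :=
  [/\ geodesic x1 x2 S12, geodesic x2 x3 S23 & geodesic x3 x1 S31].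

Definition thin (delta : R) (S12 S23 S31 : set X) : Prop :=
  [/\ forall p, S12 p -> edist_inf (S23 `|` S31) p <= delta%:E,
      forall p, S23 p -> edist_inf (S31 `|` S12) p <= delta%:E
    & forall p, S31 p -> edist_inf (S12 `|` S23) p <= delta%:E].

Definition triangle_delta (S12 S23 S31 : set X) : \bar R :=
  ereal_inf [set delta%:E | delta in
    [set delta : R | (0 <= delta)%R /\ thin delta S12 S23 S31]].

Definition hyp_const : \bar R :=
  ereal_sup [set e | exists x1 x2 x3 S12 S23 S31,
    geodesic_triangle x1 x2 x3 S12 S23 S31 /\ e = triangle_delta S12 S23 S31].

End Hyperbolicity.

Definition graph_delta (R : realType) (G : graph) : \bar R :=
  hyp_const (gpoint R G).

(* Main.v *)
Require Import Defs.
From mathcomp Require Import all_boot all_order all_algebra.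
From mathcomp Require Import all_classical all_reals all_analysis.

(** A fibre of the projection of [lexprod G1 G2] to [G1] has in it a section
    [u |-> (u, v0)].  Section and projection send every edge to an edge or to a
    vertex, so they induce 1-Lipschitz maps of the geometric realizations.  Their
    composite is the identity, hence the realization of the section is an
    isometric embedding, and it carries geodesic triangles to geodesic triangles
    with the same thinness constant. *)

Set Implicit Arguments.
Unset Strict Implicit.
Unset Printing Implicit Defensive.

Import Order.TTheory GRing.Theory Num.Theory.

Local Open Scope classical_set_scope.
Local Open Scope ring_scope.

Section IsometricEmbedding.
Variables (R : realType) (X Y : metricType R) (f : X -> Y).
Hypothesis f_isom : forall x y, mdist (f x) (f y) = mdist x y.

(** [edist] is an infimum of radii of balls, and [mdist] determines the balls. *)
Lemma edist_isometry (x y : X) : edist (f x, f y) = edist (x, y).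
Proof.
have E r : ball (f x) r (f y) = ball x r y by rewrite !ballEmdist /= f_isom.
by rewrite /edist; under eq_set do rewrite /= E.
Qed.

Lemma edist_inf_isometry (A : set X) (x : X) :
  edist_inf (f @` A) (f x) = edist_inf A x.
Proof.
rewrite /edist_inf; congr ereal_inf.
apply/seteqP; split=> e.
  by move=> [_ [a Aa <-] <-]; exists a; rewrite ?edist_isometry.
by move=> [a Aa <-]; exists (f a); [exists a|rewrite edist_isometry].
Qed.

Lemma geodesic_isometry (x y : X) (S : set X) :
  geodesic x y S -> geodesic (f x) (f y) (f @` S).
Proof.
move=> [c [c0 c1 cd ->]]; exists (f \o c).
rewrite f_isom /= c0 c1; split=> // [s t hs ht|]; first by rewrite f_isom cd.
by rewrite image_comp.
Qed.

Lemma thin_isometry (d : R) (A B C : set X) :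
  thin d (f @` A) (f @` B) (f @` C) -> thin d A B C.
Proof.
move=> [hA hB hC]; split=> p Sp; rewrite -edist_inf_isometry image_setU;
  [apply: hA | apply: hB | apply: hC]; exact: imageP.
Qed.

Lemma hyp_const_isometry : (hyp_const X <= hyp_const Y)%E.
Proof.
apply: ge_ereal_sup => _ [x1 [x2 [x3 [A [B [C [[gA gB gC] ->]]]]]]].
apply: (@le_trans _ _ (triangle_delta (f @` A) (f @` B) (f @` C))).
  (* Every [d] admissible for the image triangle is admissible for the original one, so the infimum
     for the latter runs over at least as many values. *)
  apply: le_ereal_inf_tmp => _ [d [d0 dT] <-]; apply: ereal_inf_lbound.
  by exists d => //; split=> //; exact: thin_isometry.
apply: ereal_sup_ubound; exists (f x1), (f x2), (f x3), (f @` A), (f @` B), (f @` C).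
by split=> //; split; exact: geodesic_isometry.
Qed.

End IsometricEmbedding.

(** Edges may collapse, as the projection to [G1] collapses those inside a fibre. *)
Definition weak_hom (G H : graph) (f : vert G -> vert H) : Prop :=
  forall u v, adj u v -> f u = f v \/ adj (f u) (f v).

Section Pushforward.
Variables (R : realType) (G H : graph) (f : vert G -> vert H).

(** The pushforward of [x] seen as a finitely supported mass distribution. On points it is the
    affine extension of [f], with no choice of an edge carrying the point. *)
Definition push (x : vert G -> R) : vert H -> R :=
  fun w => \sum_(u \in f @^-1` [set w]) x u.

Lemma push_baryc u v (s : R) : push (baryc u v s) = baryc (f u) (f v) s.
Proof.
apply/funext => w; rewrite /push.
have fin : finite_set [set u; v] by rewrite finite_setU; split; exact: finite_set1.
(* A unit mass at [z] is carried to a unit mass at [f z]. *)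
have sum1 z : z = u \/ z = v ->
    \sum_(a \in [set u; v]) (if a \in f @^-1` [set w] then (a == z)%:R else 0 : R)
    = (w == f z)%:R :> R.
  move=> uvz; rewrite -(@fsbig_widen _ _ _ _ [set z]) ?fsbig_set1.
  - rewrite eqxx; case: ifPn => [/set_mem/= ->|]; first by rewrite eqxx.
    by rewrite notin_setE /= => /eqP; rewrite eq_sym => /negbTE ->.
  - by move=> a ->.
  - by move=> a [_ /= /eqP /negbTE ->]; rewrite if_same.
(* The fibre may be infinite; cutting it down to the support of [baryc u v s] gives a finite sum,
   which linearity can split. *)
rewrite -(@fsbig_widen _ _ _ _ ([set u; v] `&` f @^-1` [set w])); first last.
- move=> a [/= fa]; rewrite /= /baryc => /not_andP[/not_orP[/eqP au /eqP av]|//].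
  by rewrite (negbTE au) (negbTE av) !mulr0 addr0.
- exact: subIsetr.
rewrite fsbig_mkcondr /baryc -(sum1 u) -?(sum1 v); [|by right|by left].
rewrite !mulr_fsumr -fsbig_split//; apply: eq_fsbigr => a _.
by case: ifP => _ //=; rewrite !mulr0 addr0.
Qed.

Lemma push_vbaryc u : push (vbaryc R u) = vbaryc R (f u).
Proof. by rewrite -!(baryc0 R u u) push_baryc baryc0. Qed.

Lemma baryc_diag (w : vert H) (s : R) : baryc w w s = vbaryc R w.
Proof. by apply/funext => z; rewrite /baryc -mulrDl subrK mul1r. Qed.

Hypothesis f_hom : weak_hom f.

Lemma push_gpoint (x : vert G -> R) : is_gpoint x -> is_gpoint (push x).
Proof.
move=> [[u ->]|[u [v [s [uv s01 ->]]]]].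
  by left; exists (f u); exact: push_vbaryc.
rewrite push_baryc; have [<-|fuv] := f_hom uv.
  by left; exists (f u); exact: baryc_diag.
by right; exists (f u), (f v), s.
Qed.

Definition gpush (x : gpoint R G) : gpoint R H :=
  exist _ (push (sval x)) (push_gpoint (svalP x)).

(** Induction on a path: a segment keeps its length if its edge survives, and shrinks to a point if
    its edge collapses. *)
Lemma gpush_lipschitz (x y : gpoint R G) :
  mdist (gpush x) (gpush y) <= mdist x y.
Proof.
apply: le_gdist => l; elim=> [a|a b c u v s t k uv hs ht ea eb _ IH].
  by rewrite mdistxx.
rewrite (le_trans (metric_triangle _ (gpush b) _))// lerD//.
have pa : sval (gpush a) = baryc (f u) (f v) s by rewrite /= ea push_baryc.
have pb : sval (gpush b) = baryc (f u) (f v) t by rewrite /= eb push_baryc.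
have [fuv|fuv] := f_hom uv.
  suff -> : gpush a = gpush b by rewrite mdistxx.
  by apply: gpoint_inj; rewrite pa pb fuv !baryc_diag.
apply: gdist_le; rewrite -[`|_|]addr0.
exact: gpath_step fuv hs ht pa pb (gpath_nil _).
Qed.

End Pushforward.

Lemma gpush_cancel (R : realType) (G H : graph) (f : vert G -> vert H)
    (g : vert H -> vert G) (f_hom : weak_hom f) (g_hom : weak_hom g) :
  cancel f g -> cancel (@gpush R _ _ f f_hom) (gpush g_hom).
Proof.
move=> fK x; apply: gpoint_inj => /=.
case: (svalP x) => [[u ->]|[u [v [s [_ _ ->]]]]].
  by rewrite !push_vbaryc fK.
by rewrite !push_baryc !fK.
Qed.

Lemma graph_delta_retract (R : realType) (G H : graph) (f : vert G -> vert H)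
    (g : vert H -> vert G) :
  weak_hom f -> weak_hom g -> cancel f g ->
  (graph_delta R G <= graph_delta R H)%E.
Proof.
move=> f_hom g_hom fK; apply: (@hyp_const_isometry _ _ _ (gpush f_hom)) => x y.
apply/eqP; rewrite eq_le gpush_lipschitz/=.
(* The reverse inequality is the Lipschitz bound for [g], once [x] and [y] are written as images
   under [gpush g_hom]. *)
by rewrite -{1}(gpush_cancel f_hom g_hom fK x)
  -{1}(gpush_cancel f_hom g_hom fK y) gpush_lipschitz.
Qed.

Theorem theorem3p2 (R : realType) (G1 G2 : graph) :
  (graph_delta R G1 <= graph_delta R (lexprod G1 G2))%E.
Proof.
have [v0] := vert_nonempty G2.
apply: (@graph_delta_retract _ _ (lexprod G1 G2) (fun u => (u, v0)) fst) => //.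
  by move=> u v uv; right; rewrite /= /lex_adj /= uv.
by move=> p q /orP[|/andP[/eqP]]; [right|left].
Qed.
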